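(* Let $\mathscr{V}$ be a finite set, let $F:2^{\mathscr{V}}\to\mathbb{R}$ be a non-decreasing set function with $F(\emptyset)=0$, and let $q_1,\dots,q_l\ge 1$ be integers with $k:=\sum_{i=1}^l q_i\le|\mathscr{V}|$. Then every set $\mathscr{A}$ output by the standard batch greedy algorithm with batch sizes $q_1,\dots,q_l$ (for maximizing $F(\mathscr{A})$ subject to $|\mathscr{A}|\le k$) satisfies $$F(\mathscr{A})\ \ge\ \left(1-\prod_{i=1}^{l}\left(1-\frac{q_i\,\eta_{\mathscr{V},q_i}\,\gamma_{\mathscr{V},k}}{k}\right)\right)\max_{\mathscr{B}\subseteq\mathscr{V},\,|\mathscr{B}|\le k}F(\mathscr{B}),$$ where $\gamma_{\mathscr{V},k}$ is the submodularity ratio and $\eta_{\mathscr{V},q_i}$ is the supermodularity ratio of $F$.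
   Context: Incremental gain: for $\mathscr{A},\mathscr{B}\subseteq\mathscr{V}$, $\rho_{\mathscr{A}}(\mathscr{B})=F(\mathscr{A}\cup\mathscr{B})-F(\mathscr{B})$, and $\rho_\nu(\mathscr{B})=\rho_{\{\nu\}}(\mathscr{B})$ for $\nu\in\mathscr{V}$. Non-decreasing means $F(\mathscr{A})\le F(\mathscr{B})$ whenever $\mathscr{A}\subseteq\mathscr{B}$. Submodularity ratio (for an integer $k\ge1$): $$\gamma_{\mathscr{V},k}=\min_{\mathscr{B}\subseteq\mathscr{V},\ \mathscr{A}:|\mathscr{A}|\le k,\ \mathscr{A}\cap\mathscr{B}=\emptyset}\frac{\sum_{\nu\in\mathscr{A}}\rho_\nu(\mathscr{B})}{\rho_{\mathscr{A}}(\mathscr{B})}.$$ Supermodularity ratio: $$\eta_{\mathscr{V},k}=\min_{\mathscr{B}\subseteq\mathscr{V},\ \mathscr{A}:|\mathscr{A}|\le k,\ \mathscr{A}\cap\mathscr{B}=\emptyset}\frac{\rho_{\mathscr{A}}(\mathscr{B})}{\sum_{\nu\in\mathscr{A}}\rho_\nu(\mathscr{B})}.$$ In both minima, pairs $(\mathscr{A},\mathscr{B})$ for which the denominator is zero are ignored (and the value is $1$ if no pair remains). Standard batch greedy algorithm: start with $\mathscr{A}_0=\emptyset$. For $i=1,\dots,l$, compute $\rho_a(\mathscr{A}_{i-1})$ for all $a\in\mathscr{V}\setminus\mathscr{A}_{i-1}$, let $\mathscr{Q}\subseteq\mathscr{V}\setminus\mathscr{A}_{i-1}$ with $|\mathscr{Q}|=q_i$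 consist of $q_i$ indices with the highest incremental gains (ties broken arbitrarily), and set $\mathscr{A}_i=\mathscr{A}_{i-1}\cup\mathscr{Q}$. Output $\mathscr{A}=\mathscr{A}_l$. *)

(* Defs.v *)
From mathcomp Require Import all_boot all_order all_algebra.

Set Implicit Arguments.
Unset Strict Implicit.
Unset Printing Implicit Defensive.

Import Order.TTheory GRing.Theory Num.Theory.
Local Open Scope ring_scope.

Section SetFunctions.

Variables (R : realFieldType) (V : finType).
Implicit Types (F : {set V} -> R) (A B S Q : {set V}).

Definition nondecreasing_setfun F : Prop :=
  forall A B, A \subset B -> F A <= F B.

Definition gain F A B : R := F (A :|: B) - F B.

Definition sum_gain F A B : R := \sum_(v in A) gain F [set v] B.

(* When no index satisfies P, there is nothing to minimize over, and the value
   is 1 by convention; 1 does not enter the minimum otherwise. *)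
Definition min_or1 (I : finType) (P : pred I) (f : I -> R) : R :=
  if [pick i | P i] is Some i0 then f [arg min_(i < i0 | P i) f i]%O else 1.

(* In both ratios p = (A, B). *)
Definition submodularity_ratio F (k : nat) : R :=
  min_or1
    (fun p : {set V} * {set V} =>
       [&& (#|p.1| <= k)%N, [disjoint p.1 & p.2] & gain F p.1 p.2 != 0])
    (fun p => sum_gain F p.1 p.2 / gain F p.1 p.2).

Definition supermodularity_ratio F (k : nat) : R :=
  min_or1
    (fun p : {set V} * {set V} =>
       [&& (#|p.1| <= k)%N, [disjoint p.1 & p.2] & sum_gain F p.1 p.2 != 0])
    (fun p => gain F p.1 p.2 / sum_gain F p.1 p.2).

(* All ways of breaking ties are allowed: any such Q is a legal batch. *)
Definition top_gain_batch F S (q : nat) Q : Prop :=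
  [/\ Q \subset ~: S, #|Q| = q &
      forall a b, a \in Q -> b \in ~: S :\: Q ->
        gain F [set b] S <= gain F [set a] S].

(* The batch sizes are indexed from 0, so the batch of size q i is the one
   added to As i to form As i.+1; only As 0, ..., As l matter. *)
Definition batch_greedy_output F (l : nat) (q : 'I_l -> nat) A : Prop :=
  exists As : nat -> {set V},
    [/\ As 0%N = set0,
        forall i : 'I_l, exists2 Q,
          top_gain_batch F (As i) (q i) Q & As i.+1 = As i :|: Q
      & As l = A].

(* The empty set is always feasible, so this is an attained maximum. *)
Definition max_value F (k : nat) : R :=
  F [arg max_(B > set0 | (#|B| <= k)%N) F B]%O.

End SetFunctions.

(* Main.v *)
Require Import Defs.
From mathcomp Require Import all_boot all_order all_algebra.
From mathcomp Require Import ring lra.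

(** Let [OPT] be the optimal value, attained by [B] with [#|B| <= k], and let
    the greedy algorithm add the batch [Q], of size [q], to [S].  By monotonicity
    [OPT - F S] is at most the joint gain of [B :\: S] over [S].  The chain

      gamma * joint gain of B :\: S  <=  sum of the gains over B :\: S
                                     <=  k / q * sum of the gains over Q,
      eta * sum of the gains over Q  <=  F (S :|: Q) - F S

    uses the submodularity ratio gamma, then the greedy choice (the best [q]
    elements have at least the share [q / k] of what any [k] elements collect,
    [sum_top_share]), then the supermodularity ratio eta.  Hence one batch closes
    at least the fraction [q * eta * gamma / k] of the gap to [OPT]
    ([greedy_step]).

    The gaps therefore shrink by the factors [1 - q i * eta * gamma / k], and
    multiplying these inequalities requires the factors to be nonnegative.  This
    holds because both ratios are at most 1: a singleton has ratio exactly 1, and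
    an admissible singleton exists as soon as [F] is not constant
    ([singleton_gain_neq0]); for constant [F] no pair is admissible and both
    ratios are 1 by convention. *)

Set Implicit Arguments.
Unset Strict Implicit.
Unset Printing Implicit Defensive.

Import Order.TTheory GRing.Theory Num.Theory.
Local Open Scope ring_scope.

Section MinOr1.

Variables (R : realFieldType) (I : finType) (P : pred I) (f : I -> R).

Lemma min_or1_le i : P i -> min_or1 P f <= f i.
Proof.
move=> Pi; rewrite /min_or1; case: pickP => [i0 Pi0|/(_ i)]; last by rewrite Pi.
by case: (arg_minP f Pi0) => j _; apply.
Qed.

Lemma min_or1_ge0 : (forall i, P i -> 0 <= f i) -> 0 <= min_or1 P f.
Proof.
move=> f_ge0; rewrite /min_or1; case: pickP => [i0 Pi0|_]; last exact: ler01.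
by case: (arg_minP f Pi0) => j Pj _; apply: f_ge0.
Qed.

Lemma min_or1_le1 :
  (forall i, P i -> exists2 j, P j & f j <= 1) -> min_or1 P f <= 1.
Proof.
move=> f_le1; rewrite /min_or1; case: pickP => [i0 Pi0|//].
have [j Pj fj] := f_le1 _ Pi0.
by case: (arg_minP f Pi0) => m _ /(_ _ Pj) /le_trans; apply.
Qed.

End MinOr1.

Section TopShare.

Variables (R : realFieldType) (T : finType) (f : T -> R).
Implicit Types P D Q B : {set T}.

(** This compares the averages of [f] on [D] and [P]; clearing the denominators
    keeps the empty sets in. *)
Lemma sum_cross_le P D :
  (forall a b, a \in P -> b \in D -> f b <= f a) ->
  #|P|%:R * (\sum_(b in D) f b) <= #|D|%:R * (\sum_(a in P) f a).
Proof.
move=> le_f; rewrite mulr_natl -sumr_const mulr_natl -sumr_const exchange_big /=.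
by apply: ler_sum => a aP; apply: ler_sum => b bD; apply: le_f.
Qed.

(** Only [B :\: Q] has to be compared with [Q].  The average of [f] on it is
    below the averages on [Q :\: B] and on [Q :&: B]; these two comparisons are
    kept separate, because merging them into one comparison with [Q] loses the
    weight that [Q :&: B] has on both sides. *)
Lemma sum_top_share k Q B :
  (forall a, 0 <= f a) ->
  (forall a b, a \in Q -> b \in B :\: Q -> f b <= f a) ->
  (#|Q| <= k)%N -> (#|B| <= k)%N ->
  #|Q|%:R * (\sum_(b in B) f b) <= k%:R * (\sum_(a in Q) f a).
Proof.
move=> f_ge0 le_f leQ leB.
rewrite (big_setID Q) [X in _ <= _ * X](big_setID B) /= setIC.
set X := \sum_(b in B :\: Q) f b; set Y := \sum_(a in Q :\: B) f a.
set Z := \sum_(a in Q :&: B) f a.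
have XY : #|Q :\: B|%:R * X <= #|B :\: Q|%:R * Y.
  by apply: sum_cross_le => a b /setDP[aQ _]; apply: le_f.
have XZ : #|Q :&: B|%:R * X <= #|B :\: Q|%:R * Z.
  by apply: sum_cross_le => a b /setIP[aQ _]; apply: le_f.
have X_ge0 : 0 <= X by apply: sumr_ge0.
have Y_ge0 : 0 <= Y by apply: sumr_ge0.
have Z_ge0 : 0 <= Z by apply: sumr_ge0.
have q_ge0 : 0 <= #|Q|%:R :> R by [].
have k_ge0 : 0 <= k%:R :> R by [].
have kQ_ge0 : 0 <= k%:R - #|Q|%:R :> R by rewrite subr_ge0 ler_nat.
have [BQ0|BQ_gt0] := posnP #|B :\: Q|.
  have -> : X = 0 by rewrite /X (cards0_eq BQ0) big_set0.
  by nra.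
have d_gt0 : 0 < #|B :\: Q|%:R :> R by rewrite ltr0n.
have cQ : #|Q :\: B|%:R = #|Q|%:R - #|Q :&: B|%:R :> R.
  by rewrite -(cardsID B Q) natrD addrC addKr.
have cB : 0 <= k%:R - #|Q :&: B|%:R - #|B :\: Q|%:R :> R.
  by rewrite -addrA -opprD -natrD setIC cardsID subr_ge0 ler_nat.
rewrite -(ler_pM2l d_gt0).
have kXY := ler_wpM2l k_ge0 XY; have kXZ := ler_wpM2l kQ_ge0 XZ.
rewrite cQ in kXY.
(* With c, d the sizes of Q :&: B and B :\: Q, the left-hand sides of kXY and kXZ
   add up to q * (k - c) * X, where k - c is at least d. *)
have := mulr_ge0 (mulr_ge0 q_ge0 X_ge0) cB.
by lra.
Qed.

End TopShare.

Section Gains.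

Variables (R : realFieldType) (V : finType) (F : {set V} -> R).
Hypothesis F_mono : nondecreasing_setfun F.
Implicit Types (A B S Q : {set V}) (v : V).

Lemma gain_ge0 A B : 0 <= gain F A B.
Proof. by rewrite subr_ge0; apply/F_mono/subsetUr. Qed.

Lemma sum_gain_ge0 A B : 0 <= sum_gain F A B.
Proof. by apply: sumr_ge0 => v _; apply: gain_ge0. Qed.

Lemma sum_gain1 v B : sum_gain F [set v] B = gain F [set v] B.
Proof. by rewrite /sum_gain big_set1. Qed.

(** If every singleton gain vanished, adding the elements one by one would show
    [F] to be constant. *)
Lemma singleton_gain_neq0 A B : gain F A B != 0 ->
  exists v S, [disjoint [set v] & S] /\ gain F [set v] S != 0.
Proof.
move=> gAB; have [/existsP[[v S] /= gvS]|/existsPn no_gain] :=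
    boolP [exists p : V * {set V}, gain F [set p.1] p.2 != 0].
  exists v, S; split=> //; rewrite disjoints1.
  apply: contraNN gvS => vS.
  by rewrite /gain (setUidPr _) ?subrr // sub1set.
have F_const C : F C = F set0.
  have [n] := ubnP #|C|; elim: n C => // n IH C; rewrite ltnS => leCn.
  have [->//|[v vC]] := set_0Vmem C.
  have /eqP := negPn (no_gain (v, C :\ v)).
  rewrite /gain /= setD1K // => /eqP; rewrite subr_eq0 => /eqP ->.
  by apply: IH; move: leCn; rewrite (cardsD1 v) vC.
by move: gAB; rewrite /gain !F_const subrr eqxx.
Qed.

Lemma sum_gain_neq0 A B : sum_gain F A B != 0 ->
  exists v S, [disjoint [set v] & S] /\ gain F [set v] S != 0.
Proof.
move=> sAB; have [v gv|g0] := pickP (fun v => gain F [set v] B != 0).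
  exact: singleton_gain_neq0 gv.
by case/eqP: sAB; apply: big1 => v _; apply/eqP/negPn; rewrite g0.
Qed.

Lemma submodularity_ratio_ge0 k : 0 <= submodularity_ratio F k.
Proof.
by apply: min_or1_ge0 => p _; rewrite divr_ge0 ?gain_ge0 ?sum_gain_ge0.
Qed.

Lemma supermodularity_ratio_ge0 k : 0 <= supermodularity_ratio F k.
Proof.
by apply: min_or1_ge0 => p _; rewrite divr_ge0 ?gain_ge0 ?sum_gain_ge0.
Qed.

Lemma submodularity_ratio_le1 k : (0 < k)%N -> submodularity_ratio F k <= 1.
Proof.
move=> k_gt0; apply: min_or1_le1 => -[A B] /and3P[_ _ /=].
case/singleton_gain_neq0=> v [S [dvS gvS]]; exists ([set v], S) => /=.
  by rewrite cards1 k_gt0 dvS.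
by rewrite sum_gain1 divff.
Qed.

Lemma supermodularity_ratio_le1 k : (0 < k)%N -> supermodularity_ratio F k <= 1.
Proof.
move=> k_gt0; apply: min_or1_le1 => -[A B] /and3P[_ _ /=].
case/sum_gain_neq0=> v [S [dvS gvS]]; exists ([set v], S) => /=.
  by rewrite cards1 k_gt0 dvS sum_gain1.
by rewrite sum_gain1 divff.
Qed.

(** The pairs that the minimum ignores satisfy the inequality too: their joint
    gain is 0, and a sum of gains is nonnegative. *)
Lemma submodularity_ratio_bound k A B :
  (#|A| <= k)%N -> [disjoint A & B] ->
  submodularity_ratio F k * gain F A B <= sum_gain F A B.
Proof.
move=> leA dAB; have [->|gAB] := eqVneq (gain F A B) 0.
  by rewrite mulr0 sum_gain_ge0.
rewrite -ler_pdivlMr ?lt_def ?gAB ?gain_ge0 //.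
by apply: (@min_or1_le _ _ _ _ (A, B)); rewrite /= leA dAB.
Qed.

Lemma supermodularity_ratio_bound k A B :
  (#|A| <= k)%N -> [disjoint A & B] ->
  supermodularity_ratio F k * sum_gain F A B <= gain F A B.
Proof.
move=> leA dAB; have [->|sAB] := eqVneq (sum_gain F A B) 0.
  by rewrite mulr0 gain_ge0.
rewrite -ler_pdivlMr ?lt_def ?sAB ?sum_gain_ge0 //.
by apply: (@min_or1_le _ _ _ _ (A, B)); rewrite /= leA dAB.
Qed.

(** The elements of [B :\: S] were all available to the greedy choice of [Q], and
    by monotonicity their joint gain covers the whole gap [F B - F S]; when [F B]
    is below [F S], this gap is negative and the bound costs nothing. *)
Lemma greedy_step k q S Q B :
  (0 < k)%N -> (q <= k)%N -> (#|B| <= k)%N -> top_gain_batch F S q Q ->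
  q%:R * supermodularity_ratio F q * submodularity_ratio F k / k%:R
    * (F B - F S) <= F (S :|: Q) - F S.
Proof.
move=> k_gt0 leq leB [QS cardQ topQ].
have leBS : (#|B :\: S| <= k)%N.
  by apply: leq_trans leB; rewrite subset_leq_card ?subsetDl.
have dQS : [disjoint Q & S] by rewrite disjoints_subset.
have dBS : [disjoint B :\: S & S] by rewrite disjoints_subset setDE subsetIr.
have gap : F B - F S <= gain F (B :\: S) S.
  rewrite lerD2r; apply: F_mono.
  by rewrite setUC setDE setUIr setUCr setIT subsetUr.
have sub := submodularity_ratio_bound leBS dBS.
have top : q%:R * sum_gain F (B :\: S) S <= k%:R * sum_gain F Q S.
  rewrite -cardQ; apply: sum_top_share; rewrite ?cardQ //.
    by move=> a; apply: gain_ge0.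
  move=> a b aQ /setDP[] /setDP[_ bS] bQ; apply: topQ => //.
  by rewrite !inE bQ bS.
have := supermodularity_ratio_bound (eq_leq cardQ) dQS.
rewrite {1}/gain setUC => super.
have eta0 := supermodularity_ratio_ge0 q.
have gamma0 := submodularity_ratio_ge0 k.
have kR : 0 < k%:R :> R by rewrite ltr0n.
rewrite mulrAC ler_pdivrMr // mulrC.
apply: le_trans (ler_wpM2r (ltW kR) super).
have -> : (F B - F S) * (q%:R * supermodularity_ratio F q * submodularity_ratio F k)
  = supermodularity_ratio F q * (q%:R * (submodularity_ratio F k * (F B - F S))).
  by ring.
rewrite -mulrA; apply: ler_wpM2l => //; rewrite [leRHS]mulrC.
apply: le_trans top; apply: ler_wpM2l => //.
by apply: le_trans sub; apply: ler_wpM2l.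
Qed.

Lemma greedy_factor_le1 k q : (0 < q)%N -> (q <= k)%N ->
  q%:R * supermodularity_ratio F q * submodularity_ratio F k / k%:R <= 1.
Proof.
move=> q_gt0 leqk; have k_gt0 : (0 < k)%N by apply: leq_trans leqk.
rewrite ler_pdivrMr ?ltr0n // mul1r -mulrA.
rewrite -[leRHS]mulr1 ler_pM ?ler_nat //.
  by rewrite mulr_ge0 ?supermodularity_ratio_ge0 ?submodularity_ratio_ge0.
by rewrite mulr_ile1 ?supermodularity_ratio_ge0 ?submodularity_ratio_ge0
           ?supermodularity_ratio_le1 ?submodularity_ratio_le1.
Qed.

End Gains.

Lemma max_valueP (R : realFieldType) (V : finType) (F : {set V} -> R) k :
  exists2 B : {set V}, (#|B| <= k)%N & max_value F k = F B.
Proof.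
rewrite /max_value; case: arg_maxP => /= [|B leB _]; first by rewrite cards0.
by exists B.
Qed.

Lemma prod_contraction (R : realFieldType) l (c : 'I_l -> R) (d : nat -> R) :
  (forall i, 0 <= c i) -> (forall i : 'I_l, d i.+1 <= c i * d i) ->
  d l <= (\prod_(i < l) c i) * d 0%N.
Proof.
elim: l c => [|l IHl] c c_ge0 dS; first by rewrite big_ord0 mul1r.
apply: le_trans (dS ord_max) _.
rewrite big_ord_recr /= mulrAC mulrC; apply: ler_wpM2r => //.
by apply: IHl => i //; apply: (dS (widen_ord (leqnSn l) i)).
Qed.

Theorem theorem3p1 (R : realFieldType) (V : finType) (F : {set V} -> R)
    (F_mono : nondecreasing_setfun F) (F0 : F set0 = 0)
    (l : nat) (q : 'I_l -> nat) (q_ge1 : forall i, (1 <= q i)%N)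
    (k : nat) (k_def : k = (\sum_(i < l) q i)%N) (k_le : (k <= #|V|)%N)
    (A : {set V}) (A_greedy : batch_greedy_output F q A) :
  F A >= (1 - \prod_(i < l)
                (1 - (q i)%:R * supermodularity_ratio F (q i)
                       * submodularity_ratio F k / k%:R))
         * max_value F k.
Proof.
case: A_greedy => As [As0 AsS <-].
have [B leB ->] := max_valueP F k.
have le_q i : (q i <= k)%N by rewrite k_def (bigD1 i) ?leq_addr.
pose c i := 1 - (q i)%:R * supermodularity_ratio F (q i)
                  * submodularity_ratio F k / k%:R.
have c_ge0 i : 0 <= c i by rewrite subr_ge0 greedy_factor_le1.
have gapS (i : 'I_l) : F B - F (As i.+1) <= c i * (F B - F (As i)).
  have [Q topQ ->] := AsS i.
  have k_gt0 : (0 < k)%N by apply: leq_trans (le_q i).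
  have := greedy_step F_mono k_gt0 (le_q i) leB topQ.
  by rewrite /c mulrBl mul1r; lra.
have := prod_contraction (d := fun n => F B - F (As n)) c_ge0 gapS.
by rewrite /= As0 F0 subr0 mulrBl mul1r lerBlDl lerBlDr addrC.
Qed.
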